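(* Let $s\in[0,1)$, let $\Omega\subset\mathbb{R}^N$ be a bounded open Lipschitz set, let $V,f\in L^\infty(\Omega)$, and let $u\in\mathbb{H}^s(\Omega)$ be a weak solution of $\mathcal{D}^s_\Omega u+V(x)u=f$ in $\Omega$, i.e. $$\mathcal{E}_s(u,\phi)+\int_\Omega V u\phi\,dx=\int_\Omega f\phi\,dx\qquad\text{for all }\phi\in\mathbb{H}^s(\Omega).$$ Then $u\in L^\infty(\Omega)$, and there exists a constant $c_0>0$ depending only on $N$, $\Omega$, $\|V\|_{L^\infty(\Omega)}$, $\|f\|_{L^\infty(\Omega)}$ and $\|u\|_{L^2(\Omega)}$, and independent of $s$, such that $\|u\|_{L^\infty(\Omega)}\le c_0$.
   Context: A bounded open set $\Omega\subset\mathbb{R}^N$ is a Lipschitz set if each boundary point has a neighborhood in which $\partial\Omega$ is, after rotation, the graph of a Lipschitz function. For $s\in[0,1)$: $\mathbb{H}^s(\Omega)=\{u\in L^2(\Omega):\int_\Omega\int_\Omega\frac{(u(x)-u(y))^2}{|x-y|^{N+2s}}dxdy<\infty\}$ and $\mathcal{E}_s(u,v)=\frac12\int_\Omega\int_\Omega\frac{(u(x)-u(y))(v(x)-v(y))}{|x-y|^{N+2s}}dxdy$; the operator $\mathcal{D}^s_\Omega u(x)=\lim_{\varepsilon\to0^+}\int_{\Omega\setminus B_\varepsilon(x)}\frac{u(x)-u(y)}{|x-y|^{N+2s}}dy$ is the one whose weak form is $\mathcal{E}_s$. *)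

(* Defs.v *)
From HB Require Import structures.
From mathcomp Require Import all_boot all_order all_algebra.
From mathcomp Require Import all_classical all_reals all_analysis.
Set Implicit Arguments. Unset Strict Implicit. Unset Printing Implicit Defensive.
Import Order.TTheory GRing.Theory Num.Theory.
Import numFieldNormedType.Exports.
Local Open Scope classical_set_scope.
Local Open Scope ring_scope.

(* Points of R^N, N = n.+1, are row vectors 'rV[R]_n.+1. *)

Definition enorm (R : realType) (m : nat) (x : 'rV[R]_m) : R :=
  Num.sqrt (\sum_(i < m) (x ord0 i) ^+ 2).

Definition borelRn (R : realType) (n : nat) :=
  g_sigma_algebraType (@open 'rV[R]_n.+1).

(* mu is the Lebesgue measure on the Borel sets of R^N: it is a measure
   giving every box ]a,b] its volume \prod_i (b_i - a_i).  This determines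
   mu uniquely (pi-lambda theorem). *)
Definition is_lebesgue (R : realType) (n : nat)
  (mu : {measure set (borelRn R n) -> \bar R}) : Prop :=
  forall a b : 'rV[R]_n.+1, (forall i, a ord0 i <= b ord0 i) ->
    mu [set x : borelRn R n | forall i, a ord0 i < x ord0 i <= b ord0 i]
    = (\prod_(i < n.+1) (b ord0 i - a ord0 i))%:E.

Definition bounded_Rn (R : realType) (n : nat) (O : set 'rV[R]_n.+1) : Prop :=
  exists M : R, forall x, O x -> enorm x <= M.

(* boundary of an open set *)
Definition bdry (R : realType) (n : nat) (O : set 'rV[R]_n.+1) : set 'rV[R]_n.+1 :=
  closure O `\` O.

Definition lipschitz_fun (R : realType) (n : nat) (g : 'rV[R]_n -> R) : Prop :=
  exists L : R, forall a b, `|g a - g b| <= L * enorm (a - b).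

Definition lipschitz_set (R : realType) (n : nat) (O : set 'rV[R]_n.+1) : Prop :=
  forall p, bdry O p ->
    exists U : set 'rV[R]_n.+1, open U /\ U p /\
    exists Q : 'M[R]_n.+1, Q *m Q^T = 1%:M /\ \det Q = 1 /\
    exists g : 'rV[R]_n -> R, lipschitz_fun g /\
      forall x, U x ->
        (bdry O x <->
         (x *m Q) ord0 ord_max
           = g (\row_(i < n) (x *m Q) ord0 (widen_ord (leqnSn n) i))).

Section Spaces.
Local Open Scope ereal_scope.
Variables (R : realType) (n : nat) (mu : {measure set (borelRn R n) -> \bar R}).
Variable (O : set (borelRn R n)).

Definition kern (s : R) (x y : 'rV[R]_n.+1) : R :=
  ((enorm (x - y)) `^ ((n.+1)%:R + 2 * s))^-1.

Definition in_L2 (u : borelRn R n -> R) : Prop :=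
  measurable_fun O u /\ \int[mu]_(x in O) (((u x) ^+ 2)%:E) < +oo.

Definition L2norm (u : borelRn R n -> R) : R :=
  Num.sqrt (fine (\int[mu]_(x in O) (((u x) ^+ 2)%:E))).

Definition Linf_norm (h : borelRn R n -> R) : \bar R :=
  ereal_inf [set y : \bar R | {ae mu, forall x, O x -> (`|h x|)%:E <= y}].

Definition in_Linf (h : borelRn R n -> R) : Prop :=
  measurable_fun O h /\ Linf_norm h < +oo.

Definition in_Hs (s : R) (u : borelRn R n -> R) : Prop :=
  in_L2 u /\
  \int[mu]_(x in O) \int[mu]_(y in O) ((((u x - u y) ^+ 2) * kern s x y)%:E)
    < +oo.

Definition Es (s : R) (u v : borelRn R n -> R) : \bar R :=
  (2^-1)%:E * \int[mu]_(x in O) \int[mu]_(y in O)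
     ((((u x - u y) * (v x - v y)) * kern s x y)%:E).

Definition weak_solution (s : R) (V f u : borelRn R n -> R) : Prop :=
  forall phi, in_Hs s phi ->
    Es s u phi + \int[mu]_(x in O) ((V x * u x * phi x)%:E)
    = \int[mu]_(x in O) ((f x * phi x)%:E).

End Spaces.

(* Main.v *)
(* Test the equation with phi = u - max(-c, min(u, c)).  Since phi is a nondecreasing
   function of u, the integrand of E_s(u, phi) is nonnegative, so for fixed x the kernel
   may be replaced by any smaller one K_x, bounded by C and of mass at least M on Omega.
   Expanding the product and dropping K_x(y) u(y) phi(y) >= 0 gives
     2 E_s(u, phi) >= M int u phi - 2 C |u|_1 |phi|_1.
   With M = 2 |V| + 4 the potential term is absorbed, whence
     int u phi <= (|f| + 1 + C |u|_1) |phi|_1,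
   and int u phi >= c |phi|_1 forces phi = 0 once c is large.
   The kernels K_x come from a uniform cone condition: the cone at x contains disjoint
   boxes of size comparable to their distance to x at infinitely many scales, and
   |x - y|^-N has the same mass on each, so finitely many of them have mass M.  As
   |x - y|^-(N + 2s) >= |x - y|^-N when |x - y| <= 1, the choice is independent of s. *)

Require Import Defs.
From HB Require Import structures.
From mathcomp Require Import all_boot all_order all_algebra.
From mathcomp Require Import all_classical all_reals all_analysis.
From mathcomp Require Import measurable_realfun ring lra.
Import Order.TTheory GRing.Theory Num.Theory.
Import numFieldNormedType.Exports.
Local Open Scope classical_set_scope.
Local Open Scope ring_scope.

(** * Integral comparison and the lower bound for the nonlocal energy *)

Section Integrals.
Set Implicit Arguments. Unset Strict Implicit.
Context (d : measure_display) (T : measurableType d) (R : realType).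
Context (mu : {measure set T -> \bar R}) (D : set T) (mD : measurable D).

(* The larger function [g] need not be measurable, which avoids any appeal to
   Fubini's theorem for the iterated integrals below. *)
Lemma le_integral_ge0 (f g : T -> \bar R) :
  (forall x, D x -> 0 <= f x)%E -> (forall x, D x -> f x <= g x)%E ->
  (\int[mu]_(x in D) f x <= \int[mu]_(x in D) g x)%E.
Proof.
move=> f0 fg.
have g0 x : D x -> (0 <= g x)%E by move=> Dx; exact: le_trans (f0 _ Dx) (fg _ Dx).
rewrite (ge0_integralE _ f0) (ge0_integralE _ g0).
apply: ereal_sup_le => _ [h hf <-]; exists h => // x.
apply: (le_trans (hf x)); rewrite /patch; case: ifPn => // /set_mem; exact: fg.
Qed.

Lemma EFin_Rintegral (f : T -> R) : mu.-integrable D (EFin \o f) ->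
  (\int[mu]_(x in D) (f x)%:E)%E = (\int[mu]_(x in D) f x)%:E.
Proof. by move=> ?; rewrite /Rintegral fineK//; exact: integrable_fin_num. Qed.

(** The positive part of [f] still lies below the nonnegative [g], so the comparison of nonnegative
    functions applies even when [f] changes sign. *)
Lemma Rintegral_le_integral (f : T -> R) (g : T -> \bar R) :
  mu.-integrable D (EFin \o f) -> (forall x, D x -> 0 <= g x)%E ->
  (forall x, D x -> (f x)%:E <= g x)%E ->
  ((\int[mu]_(x in D) f x)%:E <= \int[mu]_(x in D) g x)%E.
Proof.
move=> fi g0 fg; rewrite -EFin_Rintegral//.
apply: (@le_trans _ _ (\int[mu]_(x in D) (EFin \o f)^\+%E x)%E).
- apply: le_integral => //; first exact: integrable_funepos.
  by move=> x _; rewrite funeposE le_max lexx.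
- apply: le_integral_ge0 => x Dx; rewrite funeposE; first by rewrite le_max lexx orbT.
  by rewrite ge_max fg//= g0.
Qed.

Lemma integrable_EFin_le (f g : T -> R) : measurable_fun D f ->
  (forall x, D x -> `|f x| <= g x) -> mu.-integrable D (EFin \o g) ->
  mu.-integrable D (EFin \o f).
Proof.
move=> mf fg; apply: le_integrable => //; first exact/measurable_EFinP.
by move=> x Dx /=; rewrite lee_fin (le_trans (fg _ Dx))// ler_norm.
Qed.

Lemma integrable_EFinZl (k : R) (f : T -> R) : mu.-integrable D (EFin \o f) ->
  mu.-integrable D (EFin \o (fun x => k * f x)).
Proof.
move=> fi; rewrite (_ : _ \o _ = fun x => k%:E * (EFin \o f) x)%E; first exact: integrableZl.
by apply/funext => x /=; rewrite EFinM.
Qed.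

Lemma integrable_EFinD (f g : T -> R) : mu.-integrable D (EFin \o f) ->
  mu.-integrable D (EFin \o g) -> mu.-integrable D (EFin \o (fun x => f x + g x)).
Proof.
move=> fi gi; rewrite (_ : _ \o _ = (EFin \o f) \+ (EFin \o g))%E; first exact: integrableD.
by apply/funext => x /=; rewrite EFinD.
Qed.

Lemma integrable_EFinB (f g : T -> R) : mu.-integrable D (EFin \o f) ->
  mu.-integrable D (EFin \o g) -> mu.-integrable D (EFin \o (fun x => f x - g x)).
Proof.
move=> fi gi; rewrite (_ : _ \o _ = (EFin \o f) \- (EFin \o g))%E; first exact: integrableB.
by apply/funext => x /=; rewrite EFinB.
Qed.

Lemma integrable_EFin_norm (f : T -> R) : mu.-integrable D (EFin \o f) ->
  mu.-integrable D (EFin \o (fun x => `|f x|)).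
Proof. by move=> fi; exact: (integrable_norm fi). Qed.

Lemma nonlocal_energy_lower_bound (k : T -> T -> R) (M C : R) (u phi : T -> R) :
  (mu D < +oo)%E -> (forall x y, 0 <= k x y) -> 0 <= M -> 0 <= C ->
  (forall x, D x -> exists K : T -> R, [/\ measurable_fun D K,
     forall y, 0 <= K y <= C, forall y, K y <= k x y
     & (M%:E <= \int[mu]_(y in D) (K y)%:E)%E]) ->
  mu.-integrable D (EFin \o u) -> mu.-integrable D (EFin \o phi) ->
  mu.-integrable D (EFin \o (fun x => u x * phi x)) ->
  (forall x, 0 <= u x * phi x) ->
  (forall x y, 0 <= (u x - u y) * (phi x - phi y)) ->
  ((M * (\int[mu]_(x in D) (u x * phi x)) -
    2 * C * (\int[mu]_(x in D) `|u x|) * (\int[mu]_(x in D) `|phi x|))%:E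
   <= \int[mu]_(x in D) \int[mu]_(y in D)
        ((u x - u y) * (phi x - phi y) * k x y)%:E)%E.
Proof.
move=> fmu k0 M0 C0 HK ui pi upi up0 mono.
set U := \int[mu]_(x in D) `|u x|; set P := \int[mu]_(x in D) `|phi x|.
set A := \int[mu]_(x in D) (u x * phi x).
have nui := integrable_EFin_norm ui; have npi := integrable_EFin_norm pi.
(* [H x] will bound the inner integral from below; its last two terms both integrate to [C * U * P],
   hence the factor 2. *)
pose H x := M * (u x * phi x) - ((C * U) * `|phi x| + (C * P) * `|u x|).
have H2i : mu.-integrable D (EFin \o (fun x => (C * U) * `|phi x| + (C * P) * `|u x|)).
  by apply: integrable_EFinD; exact: integrable_EFinZl.
have Hi : mu.-integrable D (EFin \o H).
  by apply: integrable_EFinB => //; exact: integrable_EFinZl.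
have -> : M * A - 2 * C * U * P = \int[mu]_(x in D) H x.
  rewrite RintegralB//; last exact: integrable_EFinZl.
  rewrite RintegralD// ?RintegralZl//; try exact: integrable_EFinZl.
  by rewrite -/A -/U -/P; ring.
apply: Rintegral_le_integral => // x Dx.
  by apply: integral_ge0 => y Dy; rewrite lee_fin mulr_ge0.
have [K [mK KC Kk MK]] := HK x Dx.
have Ki : mu.-integrable D (EFin \o K).
  apply: (@integrable_EFin_le _ (fun=> C)) => //.
    by move=> y _; have /andP[K0 ?] := KC y; rewrite ger0_norm.
  apply: measurable_bounded_integrable => //.
  by exists `|C|; split; [rewrite num_real|move=> z Cz y _ /=; exact: ltW].
move: MK; rewrite EFin_Rintegral// lee_fin => MK.
(* The expanded integrand with [K] as kernel: the diagonal term at [x] is kept, the one at [y] is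
   dropped, and the cross terms are bounded using [K <= C]. *)
pose h y := (u x * phi x) * K y - ((C * `|phi x|) * `|u y| + (C * `|u x|) * `|phi y|).
have h2i : mu.-integrable D (EFin \o (fun y => (C * `|phi x|) * `|u y| + (C * `|u x|) * `|phi y|)).
  by apply: integrable_EFinD; exact: integrable_EFinZl.
have hi : mu.-integrable D (EFin \o h).
  by apply: integrable_EFinB => //; exact: integrable_EFinZl.
apply: (@le_trans _ _ (\int[mu]_(y in D) h y)%:E).
  rewrite lee_fin RintegralB//; last exact: integrable_EFinZl.
  rewrite RintegralD// ?RintegralZl//; try exact: integrable_EFinZl.
  rewrite -/U -/P /H mulrC.
  have := ler_wpM2l (up0 x) MK; lra.
apply: Rintegral_le_integral => // y Dy; first by rewrite lee_fin mulr_ge0.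
rewrite lee_fin /h; have /andP[K0 KCy] := KC y.
apply: (@le_trans _ _ ((u x - u y) * (phi x - phi y) * K y)); last exact: ler_wpM2l.
have e1 : u x * phi y <= `|u x| * `|phi y| by rewrite -normrM ler_norm.
have e2 : u y * phi x <= `|phi x| * `|u y| by rewrite mulrC -normrM ler_norm.
have e3 := ler_wpM2r K0 e1; have e4 := ler_wpM2r K0 e2.
have e5 := mulr_ge0 (up0 y) K0.
have n1 : 0 <= `|u x| * `|phi y| by rewrite mulr_ge0.
have n2 : 0 <= `|phi x| * `|u y| by rewrite mulr_ge0.
have e6 := ler_wpM2l n1 KCy; have e7 := ler_wpM2l n2 KCy.
by nra.
Qed.

End Integrals.

(** * Sup norm against Euclidean norm on row vectors *)

Section RowNorms.
Set Implicit Arguments. Unset Strict Implicit.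
Context (R : realType) (m : nat).
Implicit Types (x : 'rV[R]_m) (c : R).

Lemma row_coord_le_norm x i : `|x ord0 i| <= `|x|.
Proof.
by rewrite [leRHS]/Num.norm /= mx_normrE; apply/bigmax_geP; right => /=; exists (ord0, i).
Qed.

Lemma row_norm_le x c : 0 <= c -> (forall i, `|x ord0 i| <= c) -> `|x| <= c.
Proof.
move=> c0 xc; rewrite [leLHS]/Num.norm /= mx_normrE; apply/bigmax_leP; split => //.
by move=> [i j] _ /=; rewrite (ord1 i).
Qed.

Lemma enorm_ge0 x : 0 <= enorm x. Proof. exact: sqrtr_ge0. Qed.

Lemma row_coord_le_enorm x i : `|x ord0 i| <= enorm x.
Proof.
rewrite -sqrtr_sqr ler_sqrt; last by apply: sumr_ge0 => j _; exact: sqr_ge0.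
by rewrite (bigD1 i)//= lerDl; apply: sumr_ge0 => j _; exact: sqr_ge0.
Qed.

Lemma row_norm_le_enorm x : `|x| <= enorm x.
Proof. by apply: row_norm_le (enorm_ge0 x) _ => i; exact: row_coord_le_enorm. Qed.

Lemma enorm_le_coord x c : 0 <= c -> (forall i, `|x ord0 i| <= c) -> enorm x <= m%:R * c.
Proof.
move=> c0 xc; have mc0 : 0 <= m%:R * c by rewrite mulr_ge0.
rewrite -(ger0_norm mc0) -sqrtr_sqr ler_sqrt ?sqr_ge0//.
apply: (@le_trans _ _ (\sum_(i < m) c ^+ 2)).
  by apply: ler_sum => i _; rewrite -real_normK ?num_real// lerXn2r// ?nnegrE.
rewrite sumr_const card_ord -[leLHS]mulr_natl exprMn ler_wpM2r ?sqr_ge0//.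
by rewrite -natrX ler_nat; case: (m) => // k; rewrite leq_pmulr.
Qed.

End RowNorms.

(** * Boxes, the kernel and cones in Euclidean space *)

Section EuclideanBorel.
Set Implicit Arguments. Unset Strict Implicit.
Context (R : realType) (n : nat).
Local Notation N := n.+1.

Lemma open_measurable_borelRn (A : set 'rV[R]_N) : open A ->
  measurable (A : set (borelRn R n)).
Proof. exact: sub_sigma_algebra. Qed.

Lemma measurable_coord (i : 'I_N) :
  measurable_fun setT (fun x : borelRn R n => x ord0 i).
Proof.
move=> mT; apply: (measurability _ (RGenOInfty.measurableE R)) => //.
move=> _ [_ [a ->] <-]; rewrite setTI.
apply: open_measurable_borelRn.
by apply: open_comp => // x _; exact: coord_continuous.
Qed.

Lemma measurable_box (a b : 'rV[R]_N) : measurable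
  [set x : borelRn R n | forall i, a ord0 i < x ord0 i <= b ord0 i].
Proof.
rewrite (_ : [set _ | _] = \bigcap_(i in [set: 'I_N])
  ((fun x : borelRn R n => x ord0 i) @^-1` [set` `]a ord0 i, b ord0 i]])).
  apply: fin_bigcap_measurable => // i _.
  by rewrite -[X in measurable X]setTI; exact: measurable_coord.
apply/seteqP; split => x /= H i; first by move=> _ /=; rewrite in_itv /= H.
by have := H i I; rewrite /= in_itv.
Qed.

Lemma bounded_finite_measure (mu : {measure set (borelRn R n) -> \bar R})
  (O : set 'rV[R]_N) : is_lebesgue mu -> measurable (O : set (borelRn R n)) ->
  bounded_Rn O -> (mu O < +oo)%E.
Proof.
move=> hmu mO [M OM].
(* Boxes are open on the left, so the lower corner is moved one unit further out. *)
pose a : 'rV[R]_N := const_mx (- `|M| - 1); pose b : 'rV[R]_N := const_mx `|M|.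
apply: (@le_lt_trans _ _ (mu [set x : borelRn R n | forall i, a ord0 i < x ord0 i <= b ord0 i])).
  apply: le_measure; rewrite ?inE//; first exact: measurable_box.
  move=> x Ox i; rewrite !mxE.
  have := le_trans (row_coord_le_enorm x i) (OM _ Ox).
  move=> /le_trans/(_ (ler_norm M)); rewrite ler_norml => /andP[h ->]; rewrite andbT.
  by lra.
rewrite hmu ?ltry// => i; rewrite !mxE; have := normr_ge0 M; lra.
Qed.

Lemma kern_ge0 (s : R) (x y : 'rV[R]_N) : 0 <= kern s x y.
Proof. by rewrite invr_ge0 powR_ge0. Qed.

(** The power grows with its base, and for a base at most 1 the exponent [N + 2 s] gives at most
    what [N] gives. Independence of [s] enters here. *)
Lemma kern_lower_bound (s tau : R) (x y : 'rV[R]_N) : 0 <= s -> tau <= 1 ->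
  0 < enorm (x - y) <= tau -> tau ^- N <= kern s x y.
Proof.
move=> s0 tau1 /andP[e0 et].
have t0 := lt_le_trans e0 et.
rewrite /kern lef_pV2 ?posrE ?exprn_gt0 ?powR_gt0//.
apply: (@le_trans _ _ (tau `^ (N%:R + 2 * s))).
  apply: ge0_ler_powR => //; first by rewrite addr_ge0// mulr_ge0.
    by rewrite nnegrE ltW.
  by rewrite nnegrE ltW.
rewrite -powR_mulrn; last exact: ltW.
by apply: ger_powR; rewrite ?t0// lerDl mulr_ge0.
Qed.

(** The cone with vertex [x] and axis [d], cut at height [r]. Its opening is measured in the sup
    norm, so that it is a union of axis-parallel cubes, whose volume [is_lebesgue] provides. *)
Definition cone_at (O : set 'rV[R]_N) (x d : 'rV[R]_N) (rho r : R) : Prop :=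
  forall (t : R) (w : 'rV[R]_N), 0 < t <= r -> (forall i, `|w ord0 i| <= rho) -> O (x + t *: (d + w)).

(** Points of the box are [x + t (d + w)] with [|w| <= rho <= |d| / 2], so [|d + w|] lies between
    [|d| / 2] and [3 |d| / 2]. *)
Lemma cone_box_shell (O : set 'rV[R]_N) (x d y : 'rV[R]_N) (rho r t : R) :
  cone_at O x d rho r -> 0 < rho <= `|d| / 2 -> 0 < t <= r ->
  (forall i, (x + t *: (d - const_mx rho)) ord0 i < y ord0 i
             <= (x + t *: (d + const_mx rho)) ord0 i) ->
  O y /\ t * `|d| / 2 <= `|y - x| <= 3 / 2 * `|d| * t.
Proof.
move=> cone /andP[rho0 rhod] t0r hy; have /andP[t0 tr] := t0r.
pose w := t^-1 *: (y - x) - d.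
have wrho i : `|w ord0 i| <= rho.
  have := hy i; rewrite !mxE => /andP[h1 h2].
  rewrite ler_norml; apply/andP; split.
    rewrite -lerBlDr opprK -(ler_pM2l t0) mulrA divff ?gt_eqF// mul1r; lra.
  rewrite lerBlDr -(ler_pM2l t0) mulrA divff ?gt_eqF// mul1r; lra.
have yx : y - x = t *: (d + w).
  by rewrite /w [d + _]addrC subrK scalerA divff ?gt_eqF// scale1r.
split; first by rewrite -(subrK x y) addrC yx; exact: cone.
have wn : `|w| <= rho by apply: row_norm_le => //; exact: ltW.
rewrite yx normrZ gtr0_norm//.
have h1 := ler_normD d w.
have h2 : `|d| - `|w| <= `|d + w| by rewrite -(normrN w) -{1}(addrK w d) lerBlDr ler_normD.
by apply/andP; split; rewrite -?mulrA; first rewrite ler_pM2l//; nra.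
Qed.

End EuclideanBorel.

(** * Minorants of the kernel supported in a cone *)

Section ConeKernels.
Set Implicit Arguments. Unset Strict Implicit.
Context (R : realType) (n : nat) (mu : {measure set (borelRn R n) -> \bar R}).
Context (hmu : is_lebesgue mu).
Context (O : set 'rV[R]_n.+1) (mO : measurable (O : set (borelRn R n))).
Local Notation N := n.+1.

Lemma cone_kernels (x d : 'rV[R]_N) (rho r : R) : cone_at O x d rho r ->
  0 < rho <= `|d| / 2 -> 0 < r -> 3 / 2 * `|d| * N%:R * r <= 1 ->
  forall J : nat, let t := r / 4 ^+ J in let tau := 3 / 2 * `|d| * N%:R * t in
  exists K : borelRn R n -> R, [/\ measurable_fun setT K,
    forall y, 0 <= K y <= tau ^- N,
    forall s y, 0 <= s -> K y <= kern s x y,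
    forall y : 'rV[R]_N, `|y - x| <= 3 / 2 * `|d| * t -> K y = 0
  & (\int[mu]_(y in O) (K y)%:E)%E =
      (J%:R * (4 * rho / (3 * `|d| * N%:R)) ^+ N)%:E].
Proof.
(* Each step adds the box of the cone at scale [t], which is disjoint from the
   larger ones and on which [tau ^- N] is a lower bound of the kernel. *)
move=> cone rhod r0 r1 J.
have [rho0 rhod2] := andP rhod.
have d0 : 0 < `|d| by lra.
have N0 : 0 < N%:R :> R by rewrite ltr0n.
have DN0 : 0 < 3 / 2 * `|d| * N%:R by rewrite !mulr_gt0// ?invr_gt0.
elim: J => [|J [K [mK KC Kk K0 IK]]] /=.
  exists (cst 0); split => //.
  - by move=> y /=; rewrite lexx invr_ge0 exprn_ge0// expr0 divr1 mulr_ge0 ?ltW.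
  - by move=> s y s0; exact: kern_ge0.
  - by rewrite integral0 mul0r.
set t := r / 4 ^+ J in KC K0 *.
have -> : r / 4 ^+ J.+1 = t / 4 by rewrite exprSr invfM mulrA.
set tau := 3 / 2 * `|d| * N%:R * t in KC *.
have t0 : 0 < t by rewrite divr_gt0// exprn_gt0.
have tr : t <= r by rewrite ler_pdivrMr ?exprn_gt0// ler_peMr ?(ltW r0)// exprn_ege1// ler1n.
have tau0 : 0 < tau by rewrite mulr_gt0.
have tau1 : tau <= 1 by apply: le_trans r1; rewrite ler_pM2l.
have tauN : tau ^- N <= (3 / 2 * `|d| * N%:R * (t / 4)) ^- N.
  rewrite lef_pV2 ?posrE ?exprn_gt0// ?mulr_gt0//.
  by rewrite lerXn2r ?nnegrE ?ltW ?mulr_gt0// ltr_pM2l//; lra.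
pose a := x + t *: (d - const_mx rho); pose b := x + t *: (d + const_mx rho).
pose B := [set y : borelRn R n | forall i, a ord0 i < y ord0 i <= b ord0 i].
have mB : measurable B by exact: measurable_box.
have Bshell (y : 'rV[R]_N) : B y -> O y /\ t * `|d| / 2 <= `|y - x| <= 3 / 2 * `|d| * t.
  by move=> By; apply: cone_box_shell cone rhod _ By; rewrite t0.
(* The vanishing clause is the induction invariant: it clears the ball in which the next box is
   placed. *)
have KB (y : 'rV[R]_N) : B y -> K y = 0.
  by move=> /Bshell[_ /andP[_ h]]; exact: K0.
exists (fun y => K y + tau ^- N * \1_B y); split.
- by apply: measurable_funD => //; apply: measurable_funM.
- move=> y; have /andP[Ky0 KyC] := KC y; rewrite indicE.
  have [/set_mem By|_] := boolP (y \in B).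
    by rewrite KB// mulr1 add0r tauN invr_ge0 exprn_ge0 ?ltW.
  by rewrite mulr0 addr0 Ky0 (le_trans KyC).
- move=> s y s0; rewrite indicE.
  have [/set_mem By|_] := boolP (y \in B); last by rewrite mulr0 addr0; exact: Kk.
  rewrite KB// mulr1 add0r; apply: kern_lower_bound => //.
  have [_ /andP[h1 h2]] := Bshell _ By.
  have xy : `|x - (y : 'rV[R]_N)| = `|(y : 'rV[R]_N) - x| by rewrite distrC.
  apply/andP; split.
    apply: lt_le_trans (row_norm_le_enorm _); rewrite xy.
    by apply: lt_le_trans h1; rewrite !mulr_gt0// invr_gt0.
  have -> : tau = N%:R * (3 / 2 * `|d| * t) by rewrite /tau; ring.
  apply: enorm_le_coord => [|i]; first by rewrite !mulr_ge0 ?invr_ge0 ?ltW.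
  by apply: le_trans (row_coord_le_norm _ _) _; rewrite xy.
- move=> y hy; rewrite K0 ?add0r ?indicE; last first.
    by apply: le_trans hy _; rewrite ler_pM2l ?mulr_gt0 ?invr_gt0//; lra.
  have [/set_mem By|_] := boolP (y \in B); last by rewrite mulr0.
  (* The box at scale [t] stays [t |d| / 2] away from [x], beyond the new radius [3 t |d| / 8];
     hence the ratio 4 between scales. *)
  have [_ /andP[h1 h2]] := Bshell _ By.
  have := mulr_gt0 t0 d0; nra.
- under eq_integral do rewrite EFinD.
  rewrite ge0_integralD//; last first.
  + by apply/measurable_EFinP/measurable_funTS; apply: measurable_funM => //; exact: measurable_indic.
  + by move=> y _; rewrite lee_fin mulr_ge0// invr_ge0 exprn_ge0 ?ltW.
  + exact/measurable_EFinP/measurable_funTS.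
  + by move=> y _; rewrite lee_fin; have /andP[] := KC y.
  under [X in (_ + X)%E]eq_integral do rewrite EFinM.
  rewrite ge0_integralZl//; last first.
  + by rewrite lee_fin invr_ge0 exprn_ge0 ?ltW.
  + by apply/measurable_EFinP; exact: measurable_indic.
  rewrite integral_indic// (_ : B `&` O = B); last first.
    by apply/setIidPl => y /Bshell[].
  rewrite IK hmu; last by move=> i; rewrite !mxE; nra.
  rewrite -EFinM -EFinD; congr EFin.
  rewrite -(natr1 J) [in RHS]mulrDl mul1r; congr (_ + _).
  (* Volume [(2 rho t)^N] times height [tau^-N]: as [tau] is proportional to [t], this mass is the
     same at every scale. *)
  rewrite (eq_bigr (fun=> 2 * rho * t)); last by move=> i _; rewrite !mxE; ring.
  rewrite prodr_const card_ord -exprVn -exprMn; congr (_ ^+ _).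
  rewrite /tau; field; rewrite ?gt_eqF//.
Qed.
End ConeKernels.

(** * Uniform cone condition near each point of the closure *)

Section ConeCondition.
Set Implicit Arguments. Unset Strict Implicit.
Context (R : realType) (n : nat).
Local Notation N := n.+1.

(** Connectedness of the unit interval: the times spent in [O] form an open set, and a closed one
    too, since off [bdry O] being in [closure O] means being in [O]. *)
Lemma open_segment_avoiding_bdry (O : set 'rV[R]_N) (x v : 'rV[R]_N) : open O -> O x ->
  (forall t : R, 0 <= t <= 1 -> ~ bdry O (x + t *: v)) -> O (x + v).
Proof.
move=> oO Ox hb; pose f (t : R) : 'rV[R]_N := x + t *: v.
have cf : continuous f.
  move=> t; rewrite /continuous_at /f; apply: (@cvgD R 'rV[R]_N); [exact: cvg_cst|apply: cvgZ; [exact: cvg_id|exact: cvg_cst]].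
have f01 t : `[0, 1]%classic t -> closure O (f t) -> O (f t).
  move=> /=; rewrite in_itv /= => t01 cOt; apply: contrapT => nO.
  exact: (hb t t01).
have E : `[0, 1]%classic `&` f @^-1` O = `[0, 1]%classic.
  apply: (@segment_connected R 0 1).
  - by exists 0; split; rewrite /= ?in_itv /= ?lexx ?ler01// /f scale0r addr0.
  - by exists (f @^-1` O) => //; apply: open_comp => // t _; exact: cf.
  - exists (f @^-1` closure O).
      by apply: preimage_closed; [move=> t _; exact: cf|exact: closed_closure].
    apply/seteqP; split => t [t01 Ot]; split => //; first exact: subset_closure.
    exact: f01.
have : (`[0, 1]%classic `&` f @^-1` O) 1 by rewrite E /= in_itv /= ler01 lexx.
by move=> [_]; rewrite /f /= scale1r.
Qed.

Lemma near_row_norm (p : 'rV[R]_N) (e : R) : 0 < e -> \forall x \near p, `|p - x| < e.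
Proof. by move=> e0; apply/nbhs_ballP; exists e => //= x; rewrite mx_norm_ball. Qed.

(** Any direction serves inside a ball contained in [O]; with [t |d| <= e / 4] the cone moves by at
    most [3 e / 8]. *)
Lemma interior_cones (O : set 'rV[R]_N) (p : 'rV[R]_N) : open O -> O p ->
  exists D rho r : R, [/\ 0 < D, 0 < rho <= D / 2, 0 < r &
    \forall x \near p, O x -> exists2 d, `|d| = D & cone_at O x d rho r].
Proof.
move=> oO Op.
have /nbhs_ballP[e /= e0 pe] : nbhs p O by exact: open_nbhs_nbhs.
pose d : 'rV[R]_N := const_mx 1.
have d0 : 0 < `|d|.
  by have := row_coord_le_norm d ord0; rewrite mxE normr1; exact: lt_le_trans.
exists `|d|, (`|d| / 2), (e / (4 * `|d|)); split => //.
- by rewrite lexx divr_gt0.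
- by rewrite divr_gt0// mulr_gt0.
near=> x => _; exists d => // t w /andP[t0 tr] wd; apply: pe.
rewrite mx_norm_ball /ball_ /= opprD addrA.
have xp : `|p - x| < e / 2.
  by near: x; apply: near_row_norm; rewrite divr_gt0.
have wn : `|w| <= `|d| / 2 by apply: row_norm_le => //; rewrite divr_ge0.
apply: le_lt_trans (ler_normB _ _) _; rewrite normrZ gtr0_norm//.
have dw := ler_normD d w.
have td : t * `|d| <= e / 4.
  by move: tr; rewrite invfM mulrA ler_pdivlMr.
have : t * `|d + w| <= t * (3 / 2 * `|d|) by rewrite ler_pM2l//; lra.
by lra.
Unshelve. all: by end_near.
Qed.

(** Along the rotated last axis the height above the graph changes at unit rate, and a narrow
    opening perturbs that rate by at most one half. A cone pointing away from the graph thus avoids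
    the boundary and, starting in [O], stays there. *)
Lemma graph_cones (O U : set 'rV[R]_N) (p : 'rV[R]_N) (Q : 'M[R]_N) (g : 'rV[R]_n -> R) :
  open O -> open U -> U p -> Q *m Q^T = 1%:M -> lipschitz_fun g ->
  (forall x, U x -> bdry O x <-> (x *m Q) ord0 ord_max
     = g (\row_(i < n) (x *m Q) ord0 (widen_ord (leqnSn n) i))) ->
  exists D rho r : R, [/\ 0 < D, 0 < rho <= D / 2, 0 < r &
    \forall x \near p, O x -> exists2 d, `|d| = D & cone_at O x d rho r].
Proof.
move=> oO oU Up QQ [L Lg] hU.
have /nbhs_ballP[e /= e0 pe] : nbhs p U by exact: open_nbhs_nbhs.
pose dl : 'rV[R]_N := delta_mx ord0 ord_max.
pose d := dl *m Q^T.
have dl1 : dl ord0 ord_max = 1 by rewrite mxE !eqxx.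
have dQ : d *m Q = dl by rewrite /d -mulmxA (mulmx1C QQ) mulmx1.
have d0 : 0 < `|d|.
  rewrite normr_gt0; apply/eqP => d0; move: dQ; rewrite d0 mul0mx => /matrixP/(_ ord0 ord_max).
  by rewrite !mxE !eqxx /= => /esym/eqP; rewrite oner_eq0.
pose pr (z : 'rV[R]_N) : 'rV[R]_n := \row_(i < n) (z *m Q) ord0 (widen_ord (leqnSn n) i).
pose h (z : 'rV[R]_N) : R := (z *m Q) ord0 ord_max - g (pr z).
pose q : R := \sum_i \sum_j `|Q i j|.
have q0 : 0 <= q by apply: sumr_ge0 => i _; apply: sumr_ge0.
(* [q] bounds the effect of [Q] on coordinates and [1 + |L| n] that of the height function; [rho] is
   then taken so that [C * rho <= 1/2]. *)
pose C := (1 + `|L| * n%:R) * q + 1.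
have C0 : 0 < C by rewrite ltr_wpDl// mulr_ge0// addr_ge0// mulr_ge0.
pose rho := Num.min (`|d| / 2) (2 * C)^-1.
have rho0 : 0 < rho by rewrite lt_min divr_gt0//= invr_gt0 mulr_gt0.
have wQ (w : 'rV[R]_N) j : (forall i, `|w ord0 i| <= rho) -> `|(w *m Q) ord0 j| <= q * rho.
  move=> wr; rewrite mxE; apply: le_trans (ler_norm_sum _ _ _) _.
  rewrite mulr_suml; apply: ler_sum => i _; rewrite normrM mulrC ler_pM//.
  by rewrite (bigD1 j)//= lerDl sumr_ge0.
(* [h] is the height above the graph, and [d] its direction of growth. *)
have hstep (z w : 'rV[R]_N) (t sg : R) : 0 <= t -> (forall i, `|w ord0 i| <= rho) ->
    `|h (z + t *: (sg *: d + w)) - h z - t * sg| <= t / 2.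
  move=> t0 wr.
  have eQ j : ((z + t *: (sg *: d + w)) *m Q) ord0 j =
      (z *m Q) ord0 j + t * (sg * dl ord0 j + (w *m Q) ord0 j).
    by rewrite mulmxDl -scalemxAl mulmxDl -scalemxAl dQ !mxE.
  have Lpr : `|g (pr (z + t *: (sg *: d + w))) - g (pr z)| <= `|L| * (n%:R * (t * (q * rho))).
    apply: le_trans (Lg _ _) _.
    apply: (@le_trans _ _ (`|L| * enorm (pr (z + t *: (sg *: d + w)) - pr z))).
      by rewrite ler_wpM2r ?enorm_ge0// ler_norm.
    rewrite ler_wpM2l//; apply: enorm_le_coord; first by rewrite !mulr_ge0// ltW.
    move=> i; have -> : (pr (z + t *: (sg *: d + w)) - pr z) ord0 i =
        t * (w *m Q) ord0 (widen_ord (leqnSn n) i).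
      rewrite /pr !(mxE _ _ ord0 i) eQ.
      have -> : dl ord0 (widen_ord (leqnSn n) i) = 0.
        have /negbTE wi : widen_ord (leqnSn n) i != ord_max by rewrite -val_eqE /= neq_ltn ltn_ord.
        by rewrite mxE wi andbF.
      ring.
    by rewrite normrM (ger0_norm t0) ler_wpM2l// wQ.
  have -> : h (z + t *: (sg *: d + w)) - h z - t * sg =
      t * (w *m Q) ord0 ord_max - (g (pr (z + t *: (sg *: d + w))) - g (pr z)).
    by rewrite /h eQ dl1; ring.
  apply: le_trans (ler_normB _ _) _.
  rewrite normrM (ger0_norm t0).
  have h1 := ler_wpM2l t0 (wQ w ord_max wr).
  have h2 : C * rho <= 2^-1.
    have : rho <= (2 * C)^-1 by rewrite ge_min lexx orbT.
    by rewrite -(ler_pM2l C0) => /le_trans; apply; rewrite invfM mulrCA divff ?gt_eqF// mulr1.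
  have h3 : ((1 + `|L| * n%:R) * q) * rho <= 2^-1.
    by apply: le_trans h2; rewrite ler_wpM2r ?(ltW rho0)// /C lerDl.
  have := ler_wpM2l t0 h3; lra.
exists `|d|, rho, (e / (4 * `|d|)); split => //.
- by rewrite rho0 ge_min lexx.
- by rewrite divr_gt0// mulr_gt0.
near=> x => Ox.
have xp : `|p - x| < e / 2.
  by near: x; apply: near_row_norm; rewrite divr_gt0.
have hbd z : U z -> bdry O z <-> h z = 0.
  move=> Uz; rewrite hU// /h; split => [->|/eqP]; first by rewrite subrr.
  by rewrite subr_eq0 => /eqP.
have Ux : U x by apply: pe; rewrite mx_norm_ball /ball_ /=; lra.
have hx0 : h x != 0 by apply/eqP => /(hbd _ Ux)[_]; exact.
(* [O] may lie on either side of the graph, or on both, so the axis points to the side on which [x]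
   lies. *)
exists (Num.sg (h x) *: d); first by rewrite normrZ normr_sg hx0 mul1r.
move=> t w /andP[t0 tr] wr; apply: open_segment_avoiding_bdry => // s /andP[s0 s1].
rewrite scalerA; set z := x + _.
have st0 : 0 <= s * t by rewrite mulr_ge0// ltW.
have Uz : U z.
  apply: pe; rewrite mx_norm_ball /ball_ /= opprD addrA.
  have rd : rho <= `|d| / 2 by rewrite ge_min lexx.
  have wn : `|w| <= `|d| / 2.
    by apply: row_norm_le => [|i]; [rewrite divr_ge0|exact: le_trans (wr i) rd].
  apply: le_lt_trans (ler_normB _ _) _; rewrite normrZ ger0_norm//.
  have dw := ler_normD (Num.sg (h x) *: d) w.
  have sd : `|Num.sg (h x) *: d| = `|d| by rewrite normrZ normr_sg hx0 mul1r.
  have td : t * `|d| <= e / 4 by move: tr; rewrite invfM mulrA ler_pdivlMr.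
  have tn : t * `|Num.sg (h x) *: d + w| <= t * (3 / 2 * `|d|) by rewrite ler_pM2l//; lra.
  have : s * t * `|Num.sg (h x) *: d + w| <= t * `|Num.sg (h x) *: d + w|.
    by rewrite -mulrA ler_piMl// mulr_ge0// ltW.
  by lra.
(* A boundary point would have height 0, but the height started at [h x != 0] and moved further away
   from 0. *)
move=> /(hbd _ Uz) hz; have := hstep x w (s * t) (Num.sg (h x)) st0 wr.
rewrite -/z hz ler_norml => /andP[].
case: sgrP hx0 => //; lra.
Unshelve. all: by end_near.
Qed.

Lemma lipschitz_cones (O : set 'rV[R]_N) (p : 'rV[R]_N) : open O -> lipschitz_set O ->
  closure O p ->
  exists D rho r : R, [/\ 0 < D, 0 < rho <= D / 2, 0 < r &
    \forall x \near p, O x -> exists2 d, `|d| = D & cone_at O x d rho r].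
Proof.
move=> oO lO cp; have [Op|nOp] := pselect (O p); first exact: interior_cones.
have [U [oU [Up [Q [QQ [_ [g [Lg hU]]]]]]]] := lO p (conj cp nOp).
exact: graph_cones QQ Lg hU.
Qed.

End ConeCondition.

(** * Kernel minorants uniform over the domain *)

Section KernelMinorant.
Set Implicit Arguments. Unset Strict Implicit.
Context (R : realType) (n : nat) (mu : {measure set (borelRn R n) -> \bar R}).
Context (hmu : is_lebesgue mu).
Local Notation N := n.+1.

(** A single [K] serves all [s >= 0], so bounds derived from [M] and [C] do not involve [s]. *)
Definition kernel_minorant (O : set 'rV[R]_N) (M C : R) (x : 'rV[R]_N) : Prop :=
  exists K : borelRn R n -> R, [/\ measurable_fun setT K,
    forall y, 0 <= K y <= C, forall s y, 0 <= s -> K y <= kern s x y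
  & (M%:E <= \int[mu]_(y in O) (K y)%:E)%E].

Lemma kernel_minorant_le (O : set 'rV[R]_N) (M C C' : R) (x : 'rV[R]_N) : C <= C' ->
  kernel_minorant O M C x -> kernel_minorant O M C' x.
Proof.
move=> CC' [K [mK KC Kk MK]]; exists K; split=> // y.
by have /andP[-> /le_trans->] := KC y.
Qed.

(** The cones near [p] share [D], [rho] and [r], so the same number of scales, hence the same height
    [C], serves every nearby point. *)
Lemma local_kernel_minorant (O : set 'rV[R]_N) (p : 'rV[R]_N) (M : R) : open O ->
  lipschitz_set O -> closure O p ->
  exists C : R, \forall x \near p, O x -> kernel_minorant O M C x.
Proof.
move=> oO lO cp.
have [D [rho [r [D0 rhoD r0 nearcone]]]] := lipschitz_cones oO lO cp.
have [rho0 _] := andP rhoD.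
have N0 : 0 < N%:R :> R by rewrite ltr0n.
have DN0 : 0 < 3 / 2 * D * N%:R by rewrite !mulr_gt0// invr_gt0.
(* Shortening the cone makes every [tau] at most 1. *)
pose r' := Num.min r (3 / 2 * D * N%:R)^-1.
have r'0 : 0 < r' by rewrite lt_min r0 invr_gt0.
have r'1 : 3 / 2 * D * N%:R * r' <= 1.
  by rewrite -ler_pdivlMl// mulr1 ge_min lexx orbT.
pose q := (4 * rho / (3 * D * N%:R)) ^+ N.
have q0 : 0 < q by rewrite exprn_gt0// divr_gt0// !mulr_gt0.
(* Each scale contributes mass [q], so [J >= M / q] scales give mass [M]. *)
pose J := Num.bound `|M / q|.
exists ((3 / 2 * D * N%:R * (r' / 4 ^+ J)) ^- N).
apply: filterS nearcone => x + Ox => /(_ Ox)[d dD cone].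
have cone' : cone_at O x d rho r'.
  move=> t w /andP[t0 tr]; apply: cone; rewrite t0/=.
  by apply: le_trans tr _; rewrite ge_min lexx.
have mO := open_measurable_borelRn oO.
rewrite -dD in rhoD r'1.
have [K [mK KC Kk _ IK]] := cone_kernels hmu mO cone' rhoD r'0 r'1 J.
exists K; split=> //; first by move=> y; rewrite -dD; exact: KC.
rewrite IK lee_fin dD -/q -ler_pdivrMr//.
apply: le_trans (ler_norm _) _; by apply: ltW; apply: archi_boundP.
Qed.

(** Compactness of [closure O] makes the local heights uniform. The near-covering form, with [C]
    tending to infinity, applies because the property is monotone in [C]. *)
Lemma uniform_kernel_minorant (O : set 'rV[R]_N) (M : R) : bounded_Rn O -> open O ->
  lipschitz_set O ->
  exists2 C : R, 0 <= C & forall x, O x -> kernel_minorant O M C x.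
Proof.
move=> [B OB] oO lO.
have cB : closure O `<=` [set x | `|x| <= B].
  have clB : closed [set x : 'rV[R]_N | `|x| <= B].
    rewrite (_ : [set _ | _] = Num.norm @^-1` [set z : R | z <= B])//.
    by apply: preimage_closed; [move=> x _; exact: norm_continuous|exact: closed_le].
  apply: (@subset_trans _ (closure [set x : 'rV[R]_N | `|x| <= B])); last first.
    by rewrite -(closure_id [set x | _]).1.
  apply: closureS => x Ox /=.
  exact: le_trans (row_norm_le_enorm x) (OB _ Ox).
have cO : compact (closure O).
  apply: bounded_closed_compact; last exact: closed_closure.
  exists B; split; first exact: num_real.
  by move=> B' BB' x /cB /= /le_trans; apply; exact: ltW.
have /compact_near_coveringP/(_ R (pinfty_nbhs R)
  (fun C x => O x -> kernel_minorant O M C x)) := cO.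
case=> [x cx|C [_ HC]].
  have [C HC] := local_kernel_minorant M oO lO cx.
  exists ([set x' | O x' -> kernel_minorant O M C x'], [set C' | C <= C']).
    by split => //=; apply: nbhs_pinfty_ge; exact: num_real.
  by move=> [x' C'] /= [Hx' CC'] Ox'; apply: kernel_minorant_le CC' (Hx' Ox').
exists (Num.max C 0 + 1); first by rewrite addr_ge0// le_max lexx orbT.
move=> x Ox; apply: HC => //; last exact: subset_closure.
by rewrite ltr_pwDr// le_max lexx.
Qed.

End KernelMinorant.

(** * Bounded representatives of essentially bounded functions *)

Section LinfNorm.
Set Implicit Arguments. Unset Strict Implicit.
Context (R : realType) (n : nat) (mu : {measure set (borelRn R n) -> \bar R}).
Context (O : set (borelRn R n)) (mO : measurable O).

(** Clipping just above the essential bound changes [f] only on a null part of [O] and gives a bound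
    at every point, from which integrability of products follows by domination. *)
Lemma Linf_truncation (f : borelRn R n -> R) : in_Linf mu O f ->
  exists f' : borelRn R n -> R, [/\ measurable_fun O f',
    forall x, `|f' x| <= `|fine (Linf_norm mu O f)| + 1
  & forall g : borelRn R n -> R, measurable_fun O g ->
    (\int[mu]_(x in O) (f x * g x)%:E = \int[mu]_(x in O) (f' x * g x)%:E)%E].
Proof.
move=> [mf foo]; set F := `|fine (Linf_norm mu O f)| + 1.
have lt : (Linf_norm mu O f < F%:E)%E.
  (* The infimum is [-oo] when [O] is null, and its [fine] is then 0. *)
  rewrite /F; case: (Linf_norm mu O f) foo => [r _| |_] //=; last by rewrite ltNyr.
  by rewrite lte_fin; have := ler_norm r; lra.
have [y ay yF] := ereal_inf_lt lt.
have F0 : 0 <= F by rewrite addr_ge0.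
exists (fun x => Num.max (- F) (Num.min F (f x))); split.
- by apply: measurable_maxr => //; exact: measurable_minr.
- move=> x; rewrite ler_norml le_max lexx/= ge_max ge_min lexx/= andbT.
  by rewrite (le_trans _ F0)// oppr_le0.
- move=> g mg; apply: ae_eq_integral => //.
  + by apply/measurable_EFinP; exact: measurable_funM.
  + apply/measurable_EFinP; apply: measurable_funM => //.
    by apply: measurable_maxr => //; exact: measurable_minr.
  + apply: filterS ay => x + Ox => /(_ Ox) fxy.
    have : `|f x| <= F by rewrite -lee_fin; exact: le_trans fxy (ltW yF).
    by rewrite ler_norml => /andP[h1 h2]; rewrite min_r// max_r.
Qed.

End LinfNorm.

(** * Truncation of real numbers *)

Section Excess.
Set Implicit Arguments. Unset Strict Implicit.
Context (R : realType).

(* The part of [t] lying outside [[-c, c]]: [sign t * (|t| - c)^+]. *)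
Definition excess (c t : R) : R := t - Num.max (- c) (Num.min c t).

Variant excess_spec (c t : R) : R -> Type :=
  | ExcessAbove of c < t : excess_spec c t (t - c)
  | ExcessBelow of t < - c : excess_spec c t (t + c)
  | ExcessInside of - c <= t & t <= c : excess_spec c t 0.

Lemma excessP (c t : R) : 0 <= c -> excess_spec c t (excess c t).
Proof.
rewrite /excess => c0; have [ct|tc] := ltP c t.
  by rewrite max_r; [exact: ExcessAbove|lra].
have [tc'|ct] := ltP t (- c); first by rewrite opprK; exact: ExcessBelow.
by rewrite subrr; exact: ExcessInside.
Qed.

(** Monotonicity gives the sign of the energy integrand; the 1-Lipschitz bound keeps the test
    function in the energy space. *)
Lemma excess_le (c s t : R) : 0 <= c -> s <= t ->
  0 <= excess c t - excess c s <= t - s.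
Proof.
by move=> c0 st; apply/andP; case: (excessP s c0) => *; case: (excessP t c0) => *; split; lra.
Qed.

Lemma excess_incr (c s t : R) : 0 <= c ->
  0 <= (s - t) * (excess c s - excess c t).
Proof.
move=> c0; have [/(excess_le c0)/andP[h1 h2]|/ltW/(excess_le c0)/andP[h1 h2]] := leP s t.
  by apply: mulr_le0; lra.
by apply: mulr_ge0; lra.
Qed.

Lemma excess_dist (c s t : R) : 0 <= c ->
  (excess c s - excess c t) ^+ 2 <= (s - t) ^+ 2.
Proof.
move=> c0; wlog st : s t / s <= t.
  move=> H; have [/H//|/ltW/H h] := leP s t.
  by rewrite -sqrrN opprB (le_trans h)// -sqrrN opprB.
have /andP[h1 h2] := excess_le c0 st.
by move: (excess c s) (excess c t) h1 h2 => a b; nra.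
Qed.

Lemma norm_excess_le (c t : R) : 0 <= c -> `|excess c t| <= `|t|.
Proof.
move=> c0; have := ler_norm t; have := ler_norm (- t); rewrite normrN.
by case: (excessP t c0) => *; rewrite ler_norml; lra.
Qed.

(** A nonzero [excess c t] has the sign of [t], and then [|t| > c]. *)
Lemma mul_excess_ge (c t : R) : 0 <= c -> c * `|excess c t| <= t * excess c t.
Proof.
move=> c0; case: (excessP t c0) => [h|h|_ _]; last by rewrite normr0 !mulr0.
- by rewrite gtr0_norm; nra.
- by rewrite ltr0_norm; nra.
Qed.

Lemma excess_eq0 (c t : R) : 0 <= c -> excess c t = 0 -> `|t| <= c.
Proof. by move=> c0; rewrite ler_norml; case: (excessP t c0) => *; lra. Qed.

Lemma measurable_excess d (T : measurableType d) (D : set T) (c : R) (u : T -> R) :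
  measurable_fun D u -> measurable_fun D (fun x => excess c (u x)).
Proof.
move=> mu; apply: measurable_funB => //.
by apply: measurable_maxr => //; exact: measurable_minr.
Qed.

End Excess.

(** * Square-integrable functions on a set of finite measure *)

Section SquareIntegrable.
Set Implicit Arguments. Unset Strict Implicit.
Context (R : realType) (n : nat) (mu : {measure set (borelRn R n) -> \bar R}).
Context (O : set (borelRn R n)) (mO : measurable O) (fO : (mu O < +oo)%E).

Lemma in_L2_integrable_sqr (u : borelRn R n -> R) : in_L2 mu O u ->
  mu.-integrable O (EFin \o (fun x => u x ^+ 2)).
Proof.
move=> [mf uoo]; apply/integrableP; split.
  by apply/measurable_EFinP; exact: measurable_funX.
by under eq_integral => x _ do rewrite /= ger0_norm ?sqr_ge0//.
Qed.

(** Uses [|t| <= 1 + t^2] in place of Cauchy-Schwarz, whence the squared L2 norm in the final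
    constant. *)
Lemma in_L2_integrable (u : borelRn R n -> R) : in_L2 mu O u ->
  mu.-integrable O (EFin \o u) /\
  \int[mu]_(x in O) `|u x| <= fine (mu O) + L2norm mu O u ^+ 2.
Proof.
move=> L2u; have u2i := in_L2_integrable_sqr L2u; have [mf _] := L2u.
have c1 : mu.-integrable O (EFin \o cst 1).
  apply: measurable_bounded_integrable => //.
  by exists 1; split=> // z z1 y _ /=; rewrite normr1 ltW.
have i2 : mu.-integrable O (EFin \o (fun x => 1 + u x ^+ 2)) by exact: integrable_EFinD.
have le1 t : `|t : R| <= 1 + t ^+ 2.
  by rewrite -(real_normK (num_real t)); have := sqr_ge0 (`|t| - 1); have := sqr_ge0 `|t|; nra.
have ui : mu.-integrable O (EFin \o u) by apply: integrable_EFin_le i2 => // x _.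
split=> //.
apply: (@le_trans _ _ (\int[mu]_(x in O) (1 + u x ^+ 2))).
  by apply: le_Rintegral => //; exact: integrable_EFin_norm.
rewrite RintegralD// Rintegral_cst// mul1r lerD2l /L2norm sqr_sqrtr//.
by apply: fine_ge0; apply: integral_ge0 => x _; rewrite lee_fin sqr_ge0.
Qed.

End SquareIntegrable.

(** * The truncation as test function and the resulting bound *)

Section Truncation.
Set Implicit Arguments. Unset Strict Implicit.
Context (R : realType) (n : nat) (mu : {measure set (borelRn R n) -> \bar R}).
Context (O : set (borelRn R n)) (mO : measurable O) (fO : (mu O < +oo)%E).

Lemma in_Hs_excess (s c : R) (u : borelRn R n -> R) : 0 <= c ->
  in_Hs mu O s u -> in_Hs mu O s (fun x => excess c (u x)).
Proof.
move=> c0 [[mf u2] uE]; split; first split.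
- exact: measurable_excess.
- apply: le_lt_trans u2; apply: le_integral_ge0 => x _; rewrite lee_fin ?sqr_ge0//.
  rewrite -[leLHS]real_normK ?num_real// -[leRHS]real_normK ?num_real//.
  by rewrite lerXn2r ?nnegrE// norm_excess_le.
- apply: le_lt_trans uE; apply: le_integral_ge0 => x _.
    by apply: integral_ge0 => y _; rewrite lee_fin mulr_ge0 ?sqr_ge0 ?kern_ge0.
  apply: le_integral_ge0 => y _; rewrite lee_fin; first by rewrite mulr_ge0 ?sqr_ge0 ?kern_ge0.
  by rewrite ler_wpM2r ?kern_ge0// excess_dist.
Qed.

Lemma weak_solution_bound (C c v F s : R) (V f u : borelRn R n -> R) :
  0 <= s -> 0 <= C -> 0 <= c ->
  `|fine (Linf_norm mu O V)| <= v -> `|fine (Linf_norm mu O f)| <= F ->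
  (forall x, O x -> kernel_minorant mu O (2 * (v + 2)) C x) ->
  F + 1 + C * (fine (mu O) + L2norm mu O u ^+ 2) < c ->
  in_Linf mu O V -> in_Linf mu O f -> in_Hs mu O s u -> weak_solution mu O s V f u ->
  (Linf_norm mu O u <= c%:E)%E.
Proof.
move=> s0 C0 c0 vV Ff HK cbig iV jf Hu wu.
have v0 : 0 <= v := le_trans (normr_ge0 _) vV.
pose phi x := excess c (u x).
have [V' [mV' V'v V'E]] := Linf_truncation mO iV.
have [f' [mf' f'F f'E]] := Linf_truncation mO jf.
have Hphi : in_Hs mu O s phi by exact: in_Hs_excess.
have [L2u _] := Hu; have [mfu _] := L2u; have [[mphi _] _] := Hphi.
have [ui Ub] := in_L2_integrable mO fO L2u.
have phii : mu.-integrable O (EFin \o phi).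
  apply: integrable_EFin_le (integrable_EFin_norm ui) => // x _.
  exact: norm_excess_le.
have uphi0 x : 0 <= u x * phi x.
  by apply: le_trans (mul_excess_ge _ c0); rewrite mulr_ge0.
have muphi : measurable_fun O (fun x => u x * phi x) by exact: measurable_funM.
have uphii : mu.-integrable O (EFin \o (fun x => u x * phi x)).
  apply: integrable_EFin_le (in_L2_integrable_sqr L2u) => // x _.
  by rewrite normrM -[leRHS]real_normK ?num_real// expr2 ler_wpM2l// norm_excess_le.
have nphii := integrable_EFin_norm phii.
set U := \int[mu]_(x in O) `|u x| in Ub.
set P := \int[mu]_(x in O) `|phi x|.
set A := \int[mu]_(x in O) (u x * phi x).
(* The factor 1/2 in [Es] leaves [(v + 2) * A]; the clipped potential costs at most [(v + 1) * A],
   so one [A] survives. *)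
have LB : (((2 * (v + 2)) * A - 2 * C * U * P)%:E <= \int[mu]_(x in O) \int[mu]_(y in O)
        ((u x - u y) * (phi x - phi y) * kern s x y)%:E)%E.
  apply: nonlocal_energy_lower_bound => //.
  - by move=> x y; exact: kern_ge0.
  - by rewrite mulr_ge0// addr_ge0.
  - move=> x Ox; have [K [mK KC Kk MK]] := HK x Ox; exists K; split=> //.
    + exact: measurable_funTS.
    + by move=> y; exact: Kk.
  - by move=> x y; exact: excess_incr.
have fphi : mu.-integrable O (EFin \o (fun x => f' x * phi x)).
  apply: integrable_EFin_le (integrable_EFinZl mO (F + 1) nphii) => //.
    exact: measurable_funM.
  by move=> x _; rewrite normrM ler_wpM2r//; apply: le_trans (f'F x) _; rewrite lerD2r.
have Vphi : mu.-integrable O (EFin \o (fun x => V' x * (u x * phi x))).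
  apply: integrable_EFin_le (integrable_EFinZl mO (v + 1) uphii) => //.
    exact: measurable_funM.
  move=> x _; rewrite normrM (ger0_norm (uphi0 x)) ler_wpM2r//.
  by apply: le_trans (V'v x) _; rewrite lerD2r.
have fP : \int[mu]_(x in O) (f' x * phi x) <= (F + 1) * P.
  rewrite /P -RintegralZl//; apply: le_Rintegral => //; first exact: integrable_EFinZl.
  move=> x _; apply: le_trans (ler_norm _) _; rewrite normrM ler_wpM2r//.
  by apply: le_trans (f'F x) _; rewrite lerD2r.
have VA : - ((v + 1) * A) <= \int[mu]_(x in O) (V' x * (u x * phi x)).
  rewrite -mulNr /A -RintegralZl//; apply: le_Rintegral => //; first exact: integrable_EFinZl.
  move=> x _; rewrite ler_wpM2r// lerNl; apply: le_trans (ler_norm _) _.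
  by rewrite normrN; apply: le_trans (V'v x) _; rewrite lerD2r.
have AP : c * P <= A.
  rewrite /P -RintegralZl//; apply: le_Rintegral => //; first exact: integrable_EFinZl.
  by move=> x _; exact: mul_excess_ge.
have P0 : 0 <= P by apply: Rintegral_ge0 => x _.
have := wu phi Hphi.
under [in X in (_ + X)%E]eq_integral do rewrite -mulrA.
rewrite f'E// V'E// !EFin_Rintegral// /Es.
(* The lower bound excludes energy [-oo]; the equation, whose other terms are finite, excludes
   [+oo]. *)
move: LB; case: (integral _ _ _) => [e| |]//=; last first.
  by rewrite mulry gtr0_sg ?invr_gt0// mul1e.
rewrite lee_fin => LB [wE].
have P_le0 : P <= 0.
  have CU : C * U <= C * (fine (mu O) + L2norm mu O u ^+ 2) by rewrite ler_wpM2l.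
  have key : A <= (F + 1 + C * U) * P by nra.
  by nra.
have PE : (\int[mu]_(x in O) `|(EFin \o phi) x| = 0)%E.
  have := EFin_Rintegral mO nphii; rewrite -/P (_ : P = 0)//; lra.
have /ae_eq_integral_abs : measurable_fun O (EFin \o phi) by exact/measurable_EFinP.
move=> /(_ mu mO) [/(_ PE) + _].
move=> phi0; apply: ereal_inf_lbound; apply: filterS phi0 => x + Ox => /(_ Ox) [phix].
by rewrite lee_fin; exact: excess_eq0 phix.
Qed.

End Truncation.

(* Dimension N = n.+1. *)
Theorem theorem1p4 (R : realType) (n : nat)
  (mu : {measure set (borelRn R n) -> \bar R}) (hmu : is_lebesgue mu)
  (Omega : set 'rV[R]_n.+1)
  (hOb : bounded_Rn Omega) (hOo : open Omega) (hOl : lipschitz_set Omega) :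
  exists c0 : R -> R -> R -> R,
    (forall a b c, 0 < c0 a b c) /\
    forall (s : R) (V f u : borelRn R n -> R),
      0 <= s -> s < 1 ->
      in_Linf mu Omega V -> in_Linf mu Omega f ->
      in_Hs mu Omega s u ->
      weak_solution mu Omega s V f u ->
      in_Linf mu Omega u /\
      (Linf_norm mu Omega u <=
        (c0 (fine (Linf_norm mu Omega V)) (fine (Linf_norm mu Omega f))
            (L2norm mu Omega u))%:E)%E.
Proof.
have mO := open_measurable_borelRn hOo.
have fO := bounded_finite_measure hmu mO hOb.
(* One height is chosen per value of [a], before [s], [V], [f] and [u] are given. *)
have HC (a : R) := cid2 (uniform_kernel_minorant hmu (2 * (`|a| + 2)) hOb hOo hOl).
pose C (a : R) : R := s2val (HC a).
have C0 a : 0 <= C a := s2valP (HC a).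
have mO0 : 0 <= fine (mu Omega) by exact: fine_ge0.
(* The [2] leaves a strict margin over the [F + 1] demanded by [weak_solution_bound], and makes the
   constant positive. *)
exists (fun a b l => `|b| + 2 + C a * (fine (mu Omega) + l ^+ 2)).
have c0 (a b l : R) : 0 < `|b| + 2 + C a * (fine (mu Omega) + l ^+ 2).
  by rewrite ltr_pwDl ?mulr_ge0 ?addr_ge0 ?sqr_ge0// ltr_wpDl.
split=> // s V f u s0 _ hV hf hu hw.
set c := (X in X%:E).
have le_c : (Linf_norm mu Omega u <= c%:E)%E.
  pose v := fine (Linf_norm mu Omega V); pose F := fine (Linf_norm mu Omega f).
  apply: (@weak_solution_bound R n mu Omega mO fO (C v) c `|v| `|F| s V f u) => //.
  - exact: ltW (c0 v F _).
  - exact: (s2valP' (HC v)).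
  - by rewrite ltrD2r ltrD2l ltr1n.
split=> //; split; last exact: le_lt_trans le_c (ltry _).
by have [[]] := hu.
Qed.
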